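(* Let $L\ge 4$, $r,\ell\ge0$, $\kappa,\lambda,\epsilon\in(-1,1)$, $z>0$, $y=\frac{1-\epsilon}{1+\epsilon}$, $f=r-\ell$, $c=r\kappa-\ell\lambda$. Let $\langle\cdot\rangle_L$ denote expectation with respect to the periodic Ising measure $$\pi_L^\ast(\boldsymbol\eta)=\frac1{Z_L}\,y^{\sum_{k=1}^L\eta_k\eta_{k+1}}\,z^{\sum_{k=1}^L\eta_k}$$ on $\{0,1\}^L$, let $\rho(L)=\langle\eta_k\rangle_L$, and let $j(L)=\langle r_k-\ell_{k+1}\rangle_L$ be the stationary current of the generalized periodic Katz-Lebowitz-Spohn model (which does not depend on $k$). Then $$j(L)=(f+c)\langle\eta_k\bar\eta_{k+1}\rangle_L+(f\epsilon-c)\langle\eta_{k-1}\eta_k\bar\eta_{k+1}\rangle_L-(f\epsilon+c)\langle\eta_{k-1}\bar\eta_k\eta_{k+1}\rangle_L$$ $$=\Big[f+c-\big(f(1-\epsilon)+2c\big)\,yz\,\frac{Y_{L-1}}{Y_L}-\big((f\epsilon+c)z+(f\epsilon-c)y^2z^2\big)\frac{Y_{L-2}}{Y_L}\Big]\rho(L),$$ and in the limit $L\to\infty$, with $\rho=\lim_{L\to\infty}\rho(L)$, $$\lim_{L\to\infty}j(L)=\Big[f+c-\big(f(1-\epsilon)+2c\big)\,yz\,\lambda_0^{-1}-\big((f\epsilon+c)z+(f\epsilon-c)y^2z^2\big)\lambda_0^{-2}\Big]\rho .$$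
   Context: Site indices are modulo $L$ and $\bar\eta_k:=1-\eta_k$. The jump rates of the generalized periodic Katz-Lebowitz-Spohn model for jumps from $k$ to $k+1$ and from $k+1$ to $k$, respectively, are $$r_k(\boldsymbol\eta)=r\,\eta_k\bar\eta_{k+1}\big[(1+\kappa)(\bar\eta_{k-1}-\eta_{k+2})+(1+\epsilon)\eta_{k-1}+(1-\epsilon)\eta_{k+2}\big],$$ $$\ell_{k+1}(\boldsymbol\eta)=\ell\,\bar\eta_k\eta_{k+1}\big[(1+\lambda)(\bar\eta_{k-1}-\eta_{k+2})+(1-\epsilon)\eta_{k-1}+(1+\epsilon)\eta_{k+2}\big].$$ The transfer matrix is $\mathsf T=\begin{pmatrix}1&\sqrt z\\ \sqrt z&yz\end{pmatrix}$ with largest eigenvalue $\lambda_0=\frac12\big(1+yz+\sqrt{(1-yz)^2+4z}\big)$, and $Y_n$ denotes the lower right (i.e. $(2,2)$) entry of $\mathsf T^n$. *)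

(* Defs.v *)
From HB Require Import structures.
From mathcomp Require Import all_boot all_order all_algebra.
From mathcomp Require Import all_classical all_reals all_analysis.
From mathcomp Require Import ring lra.

Set Implicit Arguments.
Unset Strict Implicit.
Unset Printing Implicit Defensive.

Import Order.TTheory GRing.Theory Num.Theory.
Import numFieldNormedType.Exports.

Local Open Scope ring_scope.

(* Sites are the elements of 'Z_L, so that k - 1, k + 1, k + 2 are computed
   modulo L.  'Z_L is the ring of integers modulo L only for 2 <= L: for L < 2
   everything below is a junk value. *)
Definition config (L : nat) := {ffun 'Z_L -> bool}.

Definition occ {R : realType} {L : nat} (eta : config L) (k : 'Z_L) : R :=
  (eta k)%:R.

Definition vac {R : realType} {L : nat} (eta : config L) (k : 'Z_L) : R :=
  1 - occ eta k.

Definition ising_weight {R : realType} (L : nat) (y z : R) (eta : config L) : R :=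
  y ^+ (\sum_(k : 'Z_L) eta k * eta (k + 1)%R)%N * z ^+ (\sum_(k : 'Z_L) eta k)%N.

Definition partition_function {R : realType} (L : nat) (y z : R) : R :=
  \sum_(eta : config L) ising_weight y z eta.

Definition ising_measure {R : realType} (L : nat) (y z : R) (eta : config L) : R :=
  ising_weight y z eta / partition_function L y z.

Definition expect {R : realType} (L : nat) (y z : R) (g : config L -> R) : R :=
  \sum_(eta : config L) ising_measure y z eta * g eta.

(* r_k, the rate of the jump from k to k + 1 *)
Definition rate_right {R : realType} (L : nat) (r kappa epsilon : R)
    (k : 'Z_L) (eta : config L) : R :=
  r * occ eta k * vac eta (k + 1) *
  ((1 + kappa) * (vac eta (k - 1) - occ eta (k + 2))
   + (1 + epsilon) * occ eta (k - 1) + (1 - epsilon) * occ eta (k + 2)).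

(* l_(k+1), indexed by the bond (k, k + 1): the rate of the jump from k + 1 to k *)
Definition rate_left {R : realType} (L : nat) (l lambda epsilon : R)
    (k : 'Z_L) (eta : config L) : R :=
  l * vac eta k * occ eta (k + 1) *
  ((1 + lambda) * (vac eta (k - 1) - occ eta (k + 2))
   + (1 - epsilon) * occ eta (k - 1) + (1 + epsilon) * occ eta (k + 2)).

Definition site_density {R : realType} (L : nat) (y z : R) (k : 'Z_L) : R :=
  expect y z (fun eta => occ eta k).

Definition bond_current {R : realType} (L : nat)
    (y z r l kappa lambda epsilon : R) (k : 'Z_L) : R :=
  expect y z
    (fun eta => rate_right r kappa epsilon k eta
                - rate_left l lambda epsilon k eta).

(* rho(L) and j(L), evaluated at the reference site 0: they do not depend on
   the site by translation invariance. *)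
Definition density {R : realType} (y z : R) (L : nat) : R :=
  site_density y z (0 : 'Z_L).

Definition current {R : realType} (y z r l kappa lambda epsilon : R)
    (L : nat) : R :=
  bond_current y z r l kappa lambda epsilon (0 : 'Z_L).

(* Index 0 : 'I_2 is an empty site, 1 : 'I_2 an occupied one; Y_n below is
   therefore the lower right entry of the n-th power. *)
Definition transfer_matrix {R : realType} (y z : R) : 'M[R]_2 :=
  \matrix_(i < 2, j < 2)
    if i == j then (if i == 0 then 1 else y * z) else Num.sqrt z.

Definition Y {R : realType} (y z : R) (n : nat) : R :=
  (transfer_matrix y z ^+ n) 1 1.

Definition lambda0 {R : realType} (y z : R) : R :=
  (1 + y * z + Num.sqrt ((1 - y * z) ^+ 2 + 4 * z)) / 2.

Lemma lambda0_eigenvalue (R : realType) (y z : R) : 0 < z ->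
  eigenvalue (transfer_matrix y z) (lambda0 y z).
Proof.
move=> z0; set s := Num.sqrt z; set m := lambda0 y z.
have s0 : 0 < s by rewrite sqrtr_gt0.
have ss : s ^+ 2 = z by rewrite sqr_sqrtr// ltW.
have mE : (m - 1) * (m - y * z) = z.
  have D0 : 0 <= (1 - y * z) ^+ 2 + 4 * z.
    by rewrite addr_ge0 ?sqr_ge0// mulr_ge0// ltW.
  have := sqr_sqrtr D0; rewrite /m /lambda0; set t := Num.sqrt _ => tE.
  suff : 4 * ((1 + y * z + t) / 2 - 1) * ((1 + y * z + t) / 2 - y * z) = 4 * z.
    by move=> h; apply: (@mulfI _ (4 : R)); rewrite ?pnatr_eq0// mulrA.
  transitivity (t ^+ 2 - (1 - y * z) ^+ 2); first by field.
  by rewrite tE addrC addKr.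
apply/eigenvalueP; exists (\row_(j < 2) if j == 0 then s else m - 1); last first.
  by apply/eqP => /rowP /(_ 0); rewrite !mxE /= => h; move: s0; rewrite h ltxx.
apply/rowP => j; rewrite !mxE big_ord_recl big_ord1 !mxE /=.
case: (unliftP 0 j) => [j' ->|->] /=.
  rewrite (ord1 j') /= -/s -expr2 ss.
  transitivity ((m - 1) * (m - y * z) + (m - 1) * (y * z)); first by rewrite mE.
  by ring.
by rewrite -/s; ring.
Qed.

Lemma lambda0_max (R : realType) (y z a : R) : 0 < z ->
  eigenvalue (transfer_matrix y z) a -> a <= lambda0 y z.
Proof.
move=> z0 /eigenvalueP[v /rowP vE vn0]; set s := Num.sqrt z in vE *.
have ss : s ^+ 2 = z by rewrite sqr_sqrtr// ltW.
have s0 : 0 < s by rewrite sqrtr_gt0.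
have := vE 0; have := vE 1; rewrite !mxE !big_ord_recl !big_ord0 !mxE /= -/s !addr0.
rewrite (_ : lift ord0 ord0 = 1 :> 'I_2); last exact/val_inj.
rewrite -[ord0]/(0 : 'I_2).
set p := v _ _; set q := v _ _ => e1 e0.
have aE : (a - 1) * (a - y * z) = z.
  have p0 : p != 0.
    apply: contraNneq vn0 => p0; apply/eqP/rowP => j; rewrite mxE.
    have q0 : q = 0.
      by move: e0; rewrite p0 mul0r mulr0 add0r => /eqP; rewrite mulf_eq0 (gt_eqF s0) orbF => /eqP.
    case: (unliftP 0 j) => [j' ->|->] //.
    by rewrite (ord1 j') -[RHS]q0 /q; congr (v _ _); apply/val_inj.
  have e0' : q * s = p * (a - 1) by rewrite mulrBr [p * a]mulrC -e0; ring.
  have e1' : p * s = q * (a - y * z) by rewrite mulrBr [q * a]mulrC -e1; ring.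
  apply: (mulfI p0); rewrite mulrA -e0' -[RHS](congr1 ( *%R p) ss).
  transitivity (q * (a - y * z) * s); first by ring.
  by rewrite -e1'; ring.
rewrite /lambda0 ler_pdivlMr//.
have -> : (1 - y * z) ^+ 2 + 4 * z = (2 * a - 1 - y * z) ^+ 2.
  transitivity ((1 - y * z) ^+ 2 + 4 * ((a - 1) * (a - y * z))); last by ring.
  by rewrite aE.
rewrite sqrtr_sqr; have := ler_norm (2 * a - 1 - y * z); lra.
Qed.

(* Main.v *)
Require Import Defs.
From HB Require Import structures.
From mathcomp Require Import all_boot all_order all_algebra.
From mathcomp Require Import all_classical all_reals all_analysis.
From mathcomp Require Import ring lra.

Set Implicit Arguments.
Unset Strict Implicit.
Unset Printing Implicit Defensive.

Import Order.TTheory GRing.Theory Num.Theory.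
Import numFieldNormedType.Exports.

Local Open Scope classical_set_scope.
Local Open Scope ring_scope.

(** The current is a combination of a few equilibrium correlations, and each of
them is an entry of a power of the transfer matrix T.

Expanding the rates over products of occupation numbers and using linearity
leaves six correlations on at most three consecutive sites.  The Ising weight
is invariant under translations of the ring, so these reduce to the density,
<110> = <11> - <111> = <011>, <10> = rho - <11> = <01>, and <101>; collecting
the coefficients gives the first formula ([bond_currentE]).  The coincidence
<110> = <011> is what makes the four-site rates collapse to two three-site
correlations.

The weight of a configuration is the product of the entries of T along the
ring, so a sum over configurations weighted by one-site observables is the
trace of a product of matrices, one diagonal matrix in front of each factor T
([sum_closed_paths], [sum_weight_observables]).  Occupation of a site inserts
the rank-one projector P = diag(0, 1), and tr (P A) = A_11, P A P = A_11 P.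
Hence, up to the common factor 1 / Z_L, rho = Y_L, <11> = yz Y_(L-1),
<111> = (yz)^2 Y_(L-2) and <101> = z Y_(L-2).  As Y_L > 0, dividing by rho
turns these into ratios of Y ([current_ratioE]).

For the limit, T is annihilated by (X - lambda0) (X - lambda1), where
lambda1 = 1 + yz - lambda0, so every entry of T^n is u lambda0^n + v lambda1^n
([exprn_two_roots]).  Since |lambda1| < lambda0, the ratio Y_n / lambda0^n
tends to (lambda0 - 1) / (lambda0 - lambda1), which is nonzero because
lambda0 > 1, and tr T^n / lambda0^n tends to 1; therefore rho(L) converges and
Y_(L-m) / Y_L tends to lambda0^-m ([cvg_density], [cvg_Y_ratio]). *)

(** * Linearity and translation invariance of the Ising expectation *)

Lemma expectE (R : realType) (L : nat) (y z : R) (g : config L -> R) :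
  expect y z g =
    (\sum_eta ising_weight y z eta * g eta) / partition_function L y z.
Proof.
rewrite /expect big_distrl /=; apply: eq_bigr => eta _.
by rewrite /ising_measure mulrAC.
Qed.

Lemma expectD (R : realType) (L : nat) (y z : R) (g h : config L -> R) :
  expect y z (fun eta => g eta + h eta) = expect y z g + expect y z h.
Proof. by rewrite /expect -big_split; apply: eq_bigr => eta _; rewrite mulrDr. Qed.

Lemma expectZ (R : realType) (L : nat) (y z a : R) (g : config L -> R) :
  expect y z (fun eta => a * g eta) = a * expect y z g.
Proof. by rewrite /expect mulr_sumr; apply: eq_bigr => eta _; rewrite mulrCA. Qed.

Lemma expectB (R : realType) (L : nat) (y z : R) (g h : config L -> R) :
  expect y z (fun eta => g eta - h eta) = expect y z g - expect y z h.
Proof. by rewrite /expect -sumrB; apply: eq_bigr => eta _; rewrite mulrBr. Qed.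

Definition translate (L : nat) (s : 'Z_L) (eta : config L) : config L :=
  [ffun i => eta (i + s)].

Lemma translateK (L : nat) (s : 'Z_L) :
  cancel (translate s) (translate (- s)).
Proof. by move=> eta; apply/ffunP => i; rewrite !ffunE subrK. Qed.

Lemma ising_weight_translate (R : realType) (L : nat) (y z : R) (s : 'Z_L)
    (eta : config L) :
  ising_weight y z (translate s eta) = ising_weight y z eta.
Proof.
rewrite /ising_weight; congr (_ ^+ _ * _ ^+ _).
  rewrite [RHS](reindex_inj (addIr s)); apply: eq_bigr => i _.
  by rewrite !ffunE addrAC.
by rewrite [RHS](reindex_inj (addIr s)); apply: eq_bigr => i _; rewrite ffunE.
Qed.

Lemma expect_translate (R : realType) (L : nat) (y z : R) (s : 'Z_L)
    (g : config L -> R) :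
  expect y z (fun eta => g (translate s eta)) = expect y z g.
Proof.
rewrite !expectE; congr (_ / _).
rewrite [RHS](reindex_inj (can_inj (translateK s))).
by apply: eq_bigr => eta _; rewrite ising_weight_translate.
Qed.

(** * Reduction of the current to equilibrium correlations *)

Definition pair_corr (R : realType) (L : nat) (y z : R) : R :=
  expect y z (fun eta : config L => occ eta 0 * occ eta 1).

Definition triple_corr (R : realType) (L : nat) (y z : R) : R :=
  expect y z (fun eta : config L => occ eta 0 * occ eta 1 * occ eta 2).

Definition gap_corr (R : realType) (L : nat) (y z : R) : R :=
  expect y z (fun eta : config L => occ eta 0 * vac eta 1 * occ eta 2).

Lemma site_density_indep (R : realType) (L : nat) (y z : R) (k : 'Z_L) :
  site_density y z k = density y z L.
Proof.
rewrite /density /site_density -(expect_translate _ _ k (occ ^~ 0)).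
by apply: eq_bigr => eta _; rewrite /occ ffunE add0r.
Qed.

Lemma expect_pair (R : realType) (L : nat) (y z : R) (k : 'Z_L) :
  expect y z (fun eta => occ eta k * occ eta (k + 1)) = pair_corr L y z.
Proof.
rewrite /pair_corr -[RHS](expect_translate _ _ k).
by apply: eq_bigr => eta _; rewrite /occ !ffunE add0r (addrC 1).
Qed.

Lemma expect_triple (R : realType) (L : nat) (y z : R) (k : 'Z_L) :
  expect y z (fun eta => occ eta k * occ eta (k + 1) * occ eta (k + 2))
  = triple_corr L y z.
Proof.
rewrite /triple_corr -[RHS](expect_translate _ _ k).
by apply: eq_bigr => eta _; rewrite /occ !ffunE add0r !(addrC _ k).
Qed.

Lemma expect_gap (R : realType) (L : nat) (y z : R) (k : 'Z_L) :
  expect y z (fun eta => occ eta k * vac eta (k + 1) * occ eta (k + 2))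
  = gap_corr L y z.
Proof.
rewrite /gap_corr -[RHS](expect_translate _ _ k).
by apply: eq_bigr => eta _; rewrite /vac /occ !ffunE add0r !(addrC _ k).
Qed.

Lemma expect_occ_vac (R : realType) (L : nat) (y z : R) (k : 'Z_L) :
  expect y z (fun eta => occ eta k * vac eta (k + 1))
  = density y z L - pair_corr L y z.
Proof.
rewrite -(expect_pair _ _ k) -(site_density_indep _ _ k) /site_density -expectB.
by apply: eq_bigr => eta _; rewrite /vac; ring.
Qed.

(** The density is the same at [k] and [k + 1], so there are as many 01 bonds as
10 bonds. *)
Lemma expect_vac_occ (R : realType) (L : nat) (y z : R) (k : 'Z_L) :
  expect y z (fun eta => vac eta k * occ eta (k + 1))
  = density y z L - pair_corr L y z.
Proof.
rewrite -(expect_pair _ _ k) -(site_density_indep _ _ (k + 1)) /site_density -expectB.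
by apply: eq_bigr => eta _; rewrite /vac; ring.
Qed.

Lemma expect_gap_centered (R : realType) (L : nat) (y z : R) (k : 'Z_L) :
  expect y z (fun eta => occ eta (k - 1) * vac eta k * occ eta (k + 1))
  = gap_corr L y z.
Proof.
have := expect_gap y z (k - 1).
by rewrite subrK -[2]/(1 + 1) addrA subrK.
Qed.

Lemma expect_occ_occ_vac (R : realType) (L : nat) (y z : R) (k : 'Z_L) :
  expect y z (fun eta => occ eta (k - 1) * occ eta k * vac eta (k + 1))
  = pair_corr L y z - triple_corr L y z.
Proof.
rewrite -(expect_triple _ _ (k - 1)) -(expect_pair _ _ (k - 1)).
rewrite -[2]/(1 + 1) addrA !subrK -expectB.
by apply: eq_bigr => eta _; rewrite /vac; ring.
Qed.

(** Both 011 and 110 have weight <11> - <111>: a pair of occupied neighbours is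
either extended or ended by the third site, on whichever side it lies. *)
Lemma expect_vac_occ_occ (R : realType) (L : nat) (y z : R) (k : 'Z_L) :
  expect y z (fun eta => vac eta k * occ eta (k + 1) * occ eta (k + 2))
  = pair_corr L y z - triple_corr L y z.
Proof.
rewrite -(expect_triple _ _ k) -(expect_pair _ _ (k + 1)) -expectB.
have -> : k + 1 + 1 = k + 2 by rewrite -addrA.
by apply: eq_bigr => eta _; rewrite /vac; ring.
Qed.

(** The right-hand side no longer mentions [k], so this also shows that the
current is the same on every bond. *)
Lemma bond_currentE (R : realType) (L : nat)
    (y z r l kappa lambda epsilon : R) (k : 'Z_L) :
  let f := r - l in
  let c := r * kappa - l * lambda in
  bond_current y z r l kappa lambda epsilon k =
    (f + c) * (density y z L - pair_corr L y z)
    + (f * epsilon - c) * (pair_corr L y z - triple_corr L y z)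
    - (f * epsilon + c) * gap_corr L y z.
Proof.
move=> f c.
transitivity (expect y z (fun eta : config L =>
    r * (1 + kappa) * (occ eta k * vac eta (k + 1))
    - l * (1 + lambda) * (vac eta k * occ eta (k + 1))
    + r * (epsilon - kappa) * (occ eta (k - 1) * occ eta k * vac eta (k + 1))
    - r * (epsilon + kappa) * (occ eta k * vac eta (k + 1) * occ eta (k + 2))
    + l * (epsilon + lambda) * (occ eta (k - 1) * vac eta k * occ eta (k + 1))
    - l * (epsilon - lambda) * (vac eta k * occ eta (k + 1) * occ eta (k + 2)))).
  apply: eq_bigr => eta _; congr (_ * _).
  by rewrite /rate_right /rate_left /vac; ring.
rewrite expectB expectD expectB expectD expectB !expectZ.
rewrite expect_occ_vac expect_vac_occ expect_occ_occ_vac expect_gap.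
rewrite expect_gap_centered expect_vac_occ_occ.
by rewrite /f /c; ring.
Qed.

(** * Products of matrices as sums over paths *)

(** Appends a last site to a configuration on an open segment. *)
Definition extend (S : Type) (n : nat) (p : {ffun 'I_n -> S} * S) :
    {ffun 'I_n.+1 -> S} :=
  [ffun i => oapp p.1 p.2 (unlift ord_max i)].

Lemma extend_lift (S : Type) (n : nat) (p : {ffun 'I_n -> S} * S) (i : 'I_n) :
  extend p (lift ord_max i) = p.1 i.
Proof. by rewrite ffunE liftK. Qed.

Lemma extend_max (S : Type) (n : nat) (p : {ffun 'I_n -> S} * S) :
  extend p ord_max = p.2.
Proof. by rewrite ffunE unlift_none. Qed.

Lemma extend_bij (S : Type) (n : nat) : bijective (@extend S n).
Proof.
exists (fun f : {ffun 'I_n.+1 -> S} =>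
  ([ffun i => f (lift ord_max i)], f ord_max)).
  case=> g s; rewrite extend_max; congr (_, _).
  by apply/ffunP => i; rewrite ffunE extend_lift.
move=> f; apply/ffunP => i; rewrite ffunE.
by case: (unliftP ord_max i) => [j ->|->] //=; rewrite ffunE.
Qed.

Definition site_index (b : bool) : 'I_2 := if b then 1 else 0.

Lemma site_index_surj (i : 'I_2) : exists b, i = site_index b.
Proof.
case: (unliftP 0 i) => [k ->|->]; last by exists false.
by exists true; rewrite (ord1 k); apply/val_inj.
Qed.

Lemma mulmx_site_index (R : pzSemiRingType) (A B : 'M[R]_2) (i j : 'I_2) :
  (A * B) i j = \sum_b A i (site_index b) * B (site_index b) j.
Proof.
rewrite mxE big_bool /= addrC !big_ord_recl big_ord0 addr0.
by congr (_ + A _ _ * B _ _); apply/val_inj.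
Qed.

Lemma trace_site_index (R : pzSemiRingType) (A : 'M[R]_2) :
  mxtrace A = \sum_b A (site_index b) (site_index b).
Proof.
rewrite /mxtrace big_bool /= addrC !big_ord_recl big_ord0 addr0.
by congr (_ + A _ _); apply/val_inj.
Qed.

(** Both end points are kept free through the test function [G]: the induction
absorbs the last matrix into a new [G], and closing the path into a ring later
amounts to choosing [G] to be the last matrix with its indices exchanged. *)
Lemma sum_open_paths (R : comPzSemiRingType) (M : nat -> 'M[R]_2) (n : nat)
    (G : bool -> bool -> R) :
  \sum_(f : {ffun 'I_n.+1 -> bool})
      (\prod_(k < n) M k (site_index (f (widen_ord (leqnSn n) k)))
                         (site_index (f (lift ord0 k)))) * G (f ord0) (f ord_max)
  = \sum_a \sum_b (\prod_(k < n) M k) (site_index a) (site_index b) * G a b.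
Proof.
elim: n => [|n IHn] in G *.
  rewrite (reindex (fun a : bool => [ffun _ : 'I_1 => a])) /=; last first.
    exists (fun f : {ffun 'I_1 -> bool} => f ord0) => [a _|f _]; first by rewrite ffunE.
    by apply/ffunP => i; rewrite ffunE (ord1 i).
  apply: eq_bigr => a _; rewrite !big_ord0 !ffunE.
  rewrite (bigD1 a) //= big1 ?addr0 => [|b nba]; first by rewrite !mxE eqxx.
  by rewrite !mxE; case: a b nba => -[] //= _; rewrite mul0r.
rewrite (reindex (@extend bool n.+1)); last exact/onW_bij/extend_bij.
rewrite -(pair_bigA _ (fun g s =>
  (\prod_(k < n.+1) M k (site_index (extend (g, s) (widen_ord (leqnSn n.+1) k)))
                        (site_index (extend (g, s) (lift ord0 k))))
   * G (extend (g, s) ord0) (extend (g, s) ord_max))) /=.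
transitivity (\sum_(g : {ffun 'I_n.+1 -> bool})
    (\prod_(k < n) M k (site_index (g (widen_ord (leqnSn n) k)))
                       (site_index (g (lift ord0 k))))
    * \sum_b M n (site_index (g ord_max)) (site_index b) * G (g ord0) b).
  have wE (m : nat) (i : 'I_m) : widen_ord (leqnSn m) i = lift ord_max i.
    by apply: ord_inj; rewrite [RHS]lift_max.
  apply: eq_bigr => g _; rewrite big_distrr; apply: eq_bigr => b _ /=.
  rewrite extend_max [in G _ _](_ : ord0 = lift ord_max ord0); last exact/val_inj.
  rewrite extend_lift big_ord_recr /= -mulrA; congr (_ * (M _ _ _ * _)).
  - apply: eq_bigr => k _.
    rewrite wE extend_lift /=; congr (M _ _ (site_index _)).
    rewrite (_ : lift ord0 _ = lift ord_max (lift ord0 k)) ?extend_lift//.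
    by apply: ord_inj; rewrite [RHS]lift_max.
  - by rewrite wE extend_lift.
  - by congr site_index; rewrite -[RHS](extend_max (g, b)); congr (extend _ _); apply/val_inj.
rewrite (IHn (fun a s => \sum_b M n (site_index s) (site_index b) * G a b)).
apply: eq_bigr => a _.
rewrite (eq_bigr _ (fun s _ => big_distrr _ _ _)) exchange_big /=.
apply: eq_bigr => b _; rewrite big_ord_recr mulmx_site_index big_distrl /=.
by apply: eq_bigr => s _; rewrite mulrA.
Qed.

(** The bound on [L] is needed because the ring has two sites, not [L], when
[L < 2].  The matrices may differ from site to site, so that observables can
be inserted. *)
Lemma sum_closed_paths (R : comPzSemiRingType) (M : nat -> 'M[R]_2) (L : nat) :
  (1 < L)%N ->
  \sum_(eta : config L)
      \prod_(k : 'Z_L) M k (site_index (eta k)) (site_index (eta (k + 1)))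
  = mxtrace (\prod_(k < L) M k).
Proof.
(* The bond from the last site back to site 0 is the test function closing an open path. *)
case: L => [|[|n]] // _.
transitivity (\sum_(f : {ffun 'I_n.+2 -> bool})
    (\prod_(k < n.+1) M k (site_index (f (widen_ord (leqnSn n.+1) k)))
                        (site_index (f (lift ord0 k))))
    * M n.+1 (site_index (f ord_max)) (site_index (f ord0))).
  apply: eq_bigr => f _; rewrite /Zp_trunc /= big_ord_recr /=.
  congr (_ * M _ _ (site_index (f _))); last first.
    by apply/val_inj; rewrite /= addn1 modnn.
  apply: eq_bigr => k _; congr (M _ _ (site_index (f _))).
  by apply/val_inj; rewrite /= addn1 modn_small// ltnS.
rewrite (sum_open_paths M _ (fun a b => M n.+1 (site_index b) (site_index a))).
rewrite trace_site_index; apply: eq_bigr => a _.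
by rewrite [in RHS]big_ord_recr mulmx_site_index.
Qed.

(** * Correlations as entries of powers of the transfer matrix *)

(** The multiplication operator by a one-site observable. *)
Definition observable_mx (R : pzSemiRingType) (phi : bool -> R) : 'M[R]_2 :=
  diag_mx (\row_i phi (i == 1)).

Lemma observable_mxM (R : comPzSemiRingType) (phi : bool -> R) (A : 'M[R]_2)
    (a : bool) (j : 'I_2) :
  (observable_mx phi * A) (site_index a) j = phi a * A (site_index a) j.
Proof. by rewrite -[_ * A]/(_ *m A) mul_diag_mx !mxE; case: a. Qed.

Lemma observable_mx1 (R : pzSemiRingType) : observable_mx (fun=> 1 : R) = 1.
Proof. by apply/matrixP => i j; rewrite !mxE. Qed.

Lemma observable_occ (R : realType) :
  observable_mx (fun b => b%:R : R) = delta_mx 1 1.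
Proof.
apply/matrixP => i j; rewrite !mxE.
rewrite -mulrnA mulnb; congr ((nat_of_bool _)%:R).
by case: (eqVneq i 1) => //= ->; rewrite eq_sym.
Qed.

Lemma observable_vac (R : realType) :
  observable_mx (fun b => 1 - b%:R : R) = 1 - delta_mx 1 1.
Proof.
rewrite -observable_occ -observable_mx1.
by apply/matrixP => i j; rewrite !mxE mulrnBl.
Qed.

(** The factor z of an occupied site is shared as sqrt z between its two bonds,
which is what the off-diagonal entries of T record. *)
Lemma ising_weightE (R : realType) (L : nat) (y z : R) (eta : config L) :
  0 < z ->
  ising_weight y z eta = \prod_(k : 'Z_L)
    transfer_matrix y z (site_index (eta k)) (site_index (eta (k + 1))).
Proof.
move=> z0; have ss : Num.sqrt z * Num.sqrt z = z by rewrite -expr2 sqr_sqrtr ?ltW.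
transitivity (\prod_(k : 'Z_L) (y ^+ (eta k * eta (k + 1)%R)%N
    * (Num.sqrt z ^+ eta k * Num.sqrt z ^+ eta (k + 1)))).
  rewrite big_split /= prodrXr; congr (_ * _).
  have shiftE : \prod_(k : 'Z_L) Num.sqrt z ^+ eta (k + 1)
      = \prod_(k : 'Z_L) Num.sqrt z ^+ eta k.
    by rewrite [RHS](reindex_inj (addIr 1)).
  rewrite big_split /= shiftE.
  by rewrite -big_split /= -prodrXr; apply: eq_bigr => k _; rewrite -exprMn ss.
apply: eq_bigr => k _; rewrite mxE.
by case: (eta k) (eta (k + 1)) => -[]; rewrite /= ?expr0 ?expr1 ?mul1r ?mulr1 ?ss.
Qed.

(** Multiplying the bond matrix of site [k] on the left by the diagonal matrix of
[phi k] multiplies its contribution by the value of [phi k] at site [k]. *)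
Lemma sum_weight_observables (R : realType) (L : nat) (y z : R)
    (phi : nat -> bool -> R) :
  0 < z -> (1 < L)%N ->
  \sum_(eta : config L) ising_weight y z eta * \prod_(k : 'Z_L) phi k (eta k)
  = mxtrace (\prod_(k < L) (observable_mx (phi k) * transfer_matrix y z)).
Proof.
move=> z0 L1.
rewrite -(sum_closed_paths (fun k => observable_mx (phi k) * transfer_matrix y z))//.
apply: eq_bigr => eta _; rewrite ising_weightE// mulrC -big_split /=.
by apply: eq_bigr => k _; rewrite observable_mxM.
Qed.

Lemma partition_functionE (R : realType) (L : nat) (y z : R) :
  0 < z -> (1 < L)%N ->
  partition_function L y z = mxtrace (transfer_matrix y z ^+ L).
Proof.
move=> z0 L1.
transitivity (\sum_(eta : config L) ising_weight y z eta
    * \prod_(k : 'Z_L) (fun (_ : nat) (_ : bool) => 1 : R) k (eta k)).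
  by apply: eq_bigr => eta _; rewrite big1 ?mulr1.
rewrite (sum_weight_observables y (fun=> fun=> 1) z0 L1); congr mxtrace.
under eq_bigr do rewrite observable_mx1 mul1r.
by rewrite prodr_const card_ord.
Qed.

Lemma trace_delta_mx11 (R : comPzSemiRingType) (A : 'M[R]_2) :
  mxtrace (delta_mx 1 1 * A) = A 1 1.
Proof.
rewrite trace_site_index big_bool !mulmx_site_index !big_bool /= !mxE /=.
by rewrite mulr1n mulr0n !mul0r !addr0 mul1r.
Qed.

(** The projector onto the occupied state cuts a product of matrices in two. *)
Lemma mulmx_delta_mx11 (R : pzSemiRingType) (A B : 'M[R]_2) :
  (A * delta_mx 1 1 * B) 1 1 = A 1 1 * B 1 1.
Proof.
rewrite !mulmx_site_index !big_bool /= !mulmx_site_index !big_bool /= !mxE /=.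
by rewrite mulr1n mulr0n !mulr0 mulr1 !addr0 mul0r addr0.
Qed.

(** Fixing site 0 to be occupied turns the trace into a lower right entry. *)
Lemma expect_three_sites (R : realType) (n : nat) (y z : R) (phi psi : bool -> R) :
  0 < z ->
  expect y z (fun eta : config n.+3 => occ eta 0 * phi (eta 1) * psi (eta 2))
  = (transfer_matrix y z * observable_mx phi * transfer_matrix y z
     * observable_mx psi * transfer_matrix y z ^+ n.+1) 1 1
    / partition_function n.+3 y z.
Proof.
move=> z0; rewrite expectE; congr (_ / _).
pose F (k : nat) : bool -> R :=
  if k is k1.+1 then if k1 is k2.+1 then if k2 is _.+1 then fun=> 1 else psi
  else phi else fun b => b%:R.
transitivity (\sum_(eta : config n.+3) ising_weight y z eta
    * \prod_(k : 'Z_n.+3) F k (eta k)).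
  apply: eq_bigr => eta _; congr (_ * _).
  rewrite /Zp_trunc /= !big_ord_recl /= big1 // mulr1 mulrA.
  by congr (_ * phi (eta _) * psi (eta _)); apply: val_inj.
rewrite (sum_weight_observables y F z0)// !big_ord_recl /= -trace_delta_mx11.
rewrite observable_occ.
under eq_bigr do rewrite observable_mx1 mul1r.
by rewrite prodr_const card_ord exprS !mulrA.
Qed.

Lemma transfer_matrix11 (R : realType) (y z : R) : transfer_matrix y z 1 1 = y * z.
Proof. by rewrite mxE. Qed.

Lemma densityE (R : realType) (n : nat) (y z : R) : 0 < z ->
  density y z n.+3 = Y y z n.+3 / partition_function n.+3 y z.
Proof.
move=> z0; have := expect_three_sites n y (fun=> 1) (fun=> 1) z0.
rewrite observable_mx1 !mulr1 -expr2 -exprD => <-.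
by apply: eq_bigr => eta _; rewrite /= !mulr1.
Qed.

Lemma pair_corrE (R : realType) (n : nat) (y z : R) : 0 < z ->
  pair_corr n.+3 y z = y * z * Y y z n.+2 / partition_function n.+3 y z.
Proof.
move=> z0; have := expect_three_sites n y (fun b => b%:R) (fun=> 1) z0.
rewrite observable_mx1 observable_occ mulr1 -mulrA -exprS mulmx_delta_mx11.
rewrite transfer_matrix11 => <-.
by apply: eq_bigr => eta _; rewrite /= mulr1.
Qed.

Lemma triple_corrE (R : realType) (n : nat) (y z : R) : 0 < z ->
  triple_corr n.+3 y z
  = (y * z) ^+ 2 * Y y z n.+1 / partition_function n.+3 y z.
Proof.
move=> z0; have := expect_three_sites n y (fun b => b%:R) (fun b => b%:R) z0.
rewrite observable_occ !mulmx_delta_mx11.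
by rewrite transfer_matrix11 -expr2 => <-.
Qed.

(** A hole between two particles contributes T_10 T_01 = z, obtained here as
(T (1 - P) T)_11 = (T^2)_11 - T_11^2. *)
Lemma gap_corrE (R : realType) (n : nat) (y z : R) : 0 < z ->
  gap_corr n.+3 y z = z * Y y z n.+1 / partition_function n.+3 y z.
Proof.
move=> z0; have := expect_three_sites n y (fun b => 1 - b%:R) (fun b => b%:R) z0.
rewrite observable_vac observable_occ mulmx_delta_mx11.
set T := transfer_matrix y z; rewrite (_ : (T * _ * T) 1 1 = z) => [<-//|].
rewrite mulrBr mulrBl mulr1 mxE [X in _ + X]mxE mulmx_delta_mx11.
rewrite mulmx_site_index big_bool /= addrAC subrr add0r !mxE /=.
by rewrite -expr2 sqr_sqrtr// ltW.
Qed.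

Lemma transfer_matrix_ge0 (R : realType) (y z : R) (n : nat) (i j : 'I_2) :
  0 < y -> 0 < z -> 0 <= (transfer_matrix y z ^+ n) i j.
Proof.
move=> y0 z0; elim: n => [|n IHn] in i j *; first by rewrite mxE; case: eqP.
rewrite exprS mxE; apply: sumr_ge0 => k _; rewrite mulr_ge0// mxE.
by case: ifP => _; rewrite ?sqrtr_ge0//; case: ifP => _; rewrite ?mulr_ge0 ?ltW.
Qed.

Lemma Y_gt0 (R : realType) (y z : R) (n : nat) :
  0 < y -> 0 < z -> 0 < Y y z n.
Proof.
move=> y0 z0; elim: n => [|n IHn]; first by rewrite /Y mxE eqxx.
rewrite /Y exprS mulmx_site_index big_bool /= transfer_matrix11.
rewrite ltr_wpDr ?mulr_gt0//.
by rewrite mulr_ge0 ?transfer_matrix_ge0// mxE sqrtr_ge0.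
Qed.

Lemma current_ratioE (R : realType) (y z r l kappa lambda epsilon : R) (n : nat) :
  0 < y -> 0 < z ->
  let f := r - l in
  let c := r * kappa - l * lambda in
  current y z r l kappa lambda epsilon n.+3 =
    (f + c
     - (f * (1 - epsilon) + 2 * c) * (y * z) * (Y y z n.+2 / Y y z n.+3)
     - ((f * epsilon + c) * z + (f * epsilon - c) * y ^+ 2 * z ^+ 2)
       * (Y y z n.+1 / Y y z n.+3)) * density y z n.+3.
Proof.
move=> y0 z0 f c; have Yn0 := lt0r_neq0 (Y_gt0 n.+3 y0 z0).
rewrite /current bond_currentE densityE// pair_corrE// triple_corrE// gap_corrE//.
rewrite -/f -/c; set W := (partition_function _ _ _)^-1.
by field.
Qed.

(** * Spectral decomposition of the transfer matrix *)

(** From (A - a) (A - b) = 0, the image of A - b is fixed by A up to the factor a,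
and symmetrically; the identity a - b = (A - b) - (A - a) then propagates to
all powers.  Written without dividing by [a - b]. *)
Lemma exprn_two_roots (K : comNzRingType) (n : nat) (A : 'M[K]_n.+1) (a b : K)
    (m : nat) :
  (A - a%:M) * (A - b%:M) = 0 ->
  (a - b) *: A ^+ m = a ^+ m *: (A - b%:M) - b ^+ m *: (A - a%:M).
Proof.
move=> AB0.
have AC (u : K) : A * u%:M = u *: A by exact: mul_mx_scalar.
have CA (u : K) : u%:M * A = u *: A by exact: mul_scalar_mx.
have CC (u v : K) : u%:M * v%:M = (u * v)%:M :> 'M[K]_n.+1 by rewrite scalar_mxM.
have BA0 : (A - b%:M) * (A - a%:M) = 0.
  rewrite -[RHS]AB0 !mulrBl !mulrBr !AC !CA !CC (mulrC a b) !opprB.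
  by rewrite addrACA [RHS]addrACA; congr (_ + _); rewrite addrC.
have step (u v : K) : (A - u%:M) * (A - v%:M) = 0 ->
    A * (A - v%:M) = u *: (A - v%:M).
  by rewrite mulrBl => /eqP; rewrite subr_eq0 => /eqP ->; rewrite -[LHS]/(_ *m _) mul_scalar_mx.
elim: m => [|m IHm].
  rewrite !expr0 !scale1r opprB [RHS]addrC addrA subrK scalerBl.
  by rewrite -[a%:M]scalemx1 -[b%:M]scalemx1.
rewrite exprS scalerAr IHm mulrBr -!scalerAr (step _ _ AB0) (step _ _ BA0).
by rewrite !scalerA -!exprSr.
Qed.

(** The other eigenvalue of T, read off from its trace 1 + yz. *)
Definition lambda1 (R : realType) (y z : R) : R := 1 + y * z - lambda0 y z.

Lemma lambda0_gt1 (R : realType) (y z : R) :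
  0 < y -> 0 < z -> 1 < lambda0 y z.
Proof.
move=> y0 z0; rewrite /lambda0; set D := Num.sqrt _.
suff : `|1 - y * z| < D by have := ler_norm (1 - y * z); lra.
rewrite -sqrtr_sqr ltr_sqrt; first by rewrite ltrDl mulr_gt0.
by rewrite ltr_wpDl ?sqr_ge0 ?mulr_gt0.
Qed.

Lemma lambda1_lt (R : realType) (y z : R) :
  0 < y -> 0 < z -> `|lambda1 y z| < lambda0 y z.
Proof.
move=> y0 z0; have yz0 := mulr_gt0 y0 z0.
rewrite ltr_norml /lambda1 /lambda0; set D := Num.sqrt _.
suff D0 : 0 < D by lra.
by rewrite sqrtr_gt0 ltr_wpDl ?sqr_ge0 ?mulr_gt0.
Qed.

(** The product of the eigenvalues is the determinant of T. *)
Lemma lambda_mul (R : realType) (y z : R) : 0 < z ->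
  lambda0 y z * lambda1 y z = y * z - z.
Proof.
move=> z0; have D0 : 0 <= (1 - y * z) ^+ 2 + 4 * z.
  by rewrite addr_ge0 ?sqr_ge0// mulr_ge0// ltW.
have := sqr_sqrtr D0; rewrite /lambda1 /lambda0; set D := Num.sqrt _ => DE.
transitivity (((1 + y * z) ^+ 2 - D ^+ 2) / 4); first by field.
by rewrite DE; field.
Qed.

Lemma transfer_matrix_char (R : realType) (y z : R) : 0 < z ->
  (transfer_matrix y z - (lambda0 y z)%:M)
    * (transfer_matrix y z - (lambda1 y z)%:M) = 0.
Proof.
move=> z0; have ss : Num.sqrt z * Num.sqrt z = z by rewrite -expr2 sqr_sqrtr ?ltW.
have ab := lambda_mul y z0.
have : lambda0 y z + lambda1 y z = 1 + y * z by rewrite /lambda1; ring.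
move: ab ss; set a := lambda0 y z; set b := lambda1 y z; set s := Num.sqrt z.
move=> ab ss apb; have bE : b = 1 + y * z - a by rewrite -apb; ring.
have aE : a * (1 + y * z - a) = y * z - z by rewrite -bE.
apply/matrixP => i j.
have [p ->] := site_index_surj i; have [q ->] := site_index_surj j.
rewrite mulmx_site_index big_bool !mxE /= -/s bE.
case: p q => -[] /=; rewrite !mulr1n !mulr0n.
- transitivity (s * s + a * (1 + y * z - a) - y * z); first by ring.
  by rewrite ss aE; ring.
- by ring.
- by ring.
- transitivity (s * s + a * (1 + y * z - a) - y * z); first by ring.
  by rewrite ss aE; ring.
Qed.

(** * The thermodynamic limit *)

Lemma cvg_two_exponentials (R : realType) (a b u v : R) :
  `|b| < a ->
  (fun n => (u * a ^+ n + v * b ^+ n) / a ^+ n) @ \oo --> u.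
Proof.
move=> ba; have a0 : a != 0 by rewrite gt_eqF// (le_lt_trans _ ba).
have -> : (fun n => (u * a ^+ n + v * b ^+ n) / a ^+ n)
    = (fun n => u + v * (b / a) ^+ n).
  apply/funext => n; rewrite expr_div_n.
  by field; rewrite expf_neq0.
rewrite -[X in _ --> X]addr0 -[X in _ --> _ + X](mulr0 v).
apply: cvgD; first exact: cvg_cst.
apply: cvgM; first exact: cvg_cst.
apply: cvg_expr; rewrite normrM normfV ltr_pdivrMr ?mul1r ?normr_gt0//.
by rewrite (lt_le_trans ba)// ler_norm.
Qed.

(** The coefficient of lambda0^n in [Y y z n]; it is the limit of rho(L) because
the coefficient in the trace is 1. *)
Definition limit_density (R : realType) (y z : R) : R :=
  (lambda0 y z - 1) / (lambda0 y z - lambda1 y z).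

Lemma lambda_gap_neq0 (R : realType) (y z : R) :
  0 < y -> 0 < z -> lambda0 y z - lambda1 y z != 0.
Proof.
move=> y0 z0; rewrite subr_eq0 gt_eqF//.
exact: le_lt_trans (ler_norm _) (lambda1_lt y0 z0).
Qed.

Lemma transfer_matrix_exprE (R : realType) (y z : R) (n : nat) :
  0 < y -> 0 < z ->
  transfer_matrix y z ^+ n = (lambda0 y z - lambda1 y z)^-1 *:
    (lambda0 y z ^+ n *: (transfer_matrix y z - (lambda1 y z)%:M)
     - lambda1 y z ^+ n *: (transfer_matrix y z - (lambda0 y z)%:M)).
Proof.
move=> y0 z0; rewrite -(exprn_two_roots _ (transfer_matrix_char y z0)).
by rewrite scalerA mulVf ?scale1r// lambda_gap_neq0.
Qed.

Lemma cvg_Y (R : realType) (y z : R) : 0 < y -> 0 < z ->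
  (fun n => Y y z n / lambda0 y z ^+ n) @ \oo --> limit_density y z.
Proof.
move=> y0 z0; have dn0 := lambda_gap_neq0 y0 z0.
have -> : Y y z = (fun n => limit_density y z * lambda0 y z ^+ n
    + (lambda0 y z - y * z) / (lambda0 y z - lambda1 y z) * lambda1 y z ^+ n).
  apply/funext => n; rewrite /Y transfer_matrix_exprE// !mxE /= !mulr1n.
  rewrite /limit_density (_ : y * z - lambda1 y z = lambda0 y z - 1).
    by ring.
  by rewrite /lambda1; ring.
exact: cvg_two_exponentials (lambda1_lt y0 z0).
Qed.

Lemma cvg_trace (R : realType) (y z : R) : 0 < y -> 0 < z ->
  (fun n => mxtrace (transfer_matrix y z ^+ n) / lambda0 y z ^+ n) @ \oo --> (1 : R).
Proof.
move=> y0 z0; have dn0 := lambda_gap_neq0 y0 z0.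
have trE n : mxtrace (transfer_matrix y z ^+ n)
    = 1 * lambda0 y z ^+ n + 1 * lambda1 y z ^+ n.
  rewrite transfer_matrix_exprE// trace_site_index big_bool.
  rewrite !mxE /= !mulr1n; move: dn0; rewrite /lambda1 => dn0.
  by field.
under eq_fun do rewrite trE.
exact: cvg_two_exponentials (lambda1_lt y0 z0).
Qed.

Lemma limit_density_neq0 (R : realType) (y z : R) :
  0 < y -> 0 < z -> limit_density y z != 0.
Proof.
move=> y0 z0; rewrite mulf_neq0 ?invr_neq0 ?lambda_gap_neq0//.
by rewrite subr_eq0 gt_eqF// lambda0_gt1.
Qed.

Lemma cvg_density (R : realType) (y z : R) : 0 < y -> 0 < z ->
  density y z @ \oo --> limit_density y z.
Proof.
move=> y0 z0; have a0 : lambda0 y z != 0.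
  by rewrite gt_eqF// (lt_trans ltr01)// lambda0_gt1.
have h : (fun n => (Y y z n / lambda0 y z ^+ n)
    / (mxtrace (transfer_matrix y z ^+ n) / lambda0 y z ^+ n)) @ \oo
    --> limit_density y z.
  rewrite -[X in _ --> X]divr1.
  by apply: cvgM; [exact: cvg_Y|apply: cvgV; [exact: oner_neq0|exact: cvg_trace]].
apply: cvg_trans h; apply: near_eq_cvg; near=> n.
have n3 : (3 <= n)%N by near: n; exact: nbhs_infty_ge.
rewrite -(subnK n3) addn3.
rewrite densityE// partition_functionE// invf_div mulrA divfK// expf_neq0//.
Unshelve. all: by end_near.
Qed.

(** Both [Y y z (n - m)] and [Y y z n] are of the order of a power of lambda0 with
the same nonzero prefactor; the index is shifted by [m] to avoid the truncated
subtraction. *)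
Lemma cvg_Y_ratio (R : realType) (y z : R) (m : nat) : 0 < y -> 0 < z ->
  (fun n => Y y z (n - m) / Y y z n) @ \oo --> lambda0 y z ^- m.
Proof.
move=> y0 z0; have a0 : lambda0 y z != 0.
  by rewrite gt_eqF// (lt_trans ltr01)// lambda0_gt1.
have Y_shift : (fun n => Y y z (n + m)%N / lambda0 y z ^+ (n + m)) @ \oo
    --> limit_density y z.
  by have := cvg_Y y0 z0; rewrite -(cvg_shiftn m); exact.
have h : (fun n => (Y y z n / lambda0 y z ^+ n)
    / (Y y z (n + m)%N / lambda0 y z ^+ (n + m)) * lambda0 y z ^- m) @ \oo
    --> lambda0 y z ^- m.
  rewrite -[X in _ --> X]mul1r -(divff (limit_density_neq0 y0 z0)).
  apply: cvgM; last exact: cvg_cst.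
  apply: cvgM; first exact: cvg_Y.
  by apply: cvgV => //; exact: limit_density_neq0.
rewrite -(cvg_shiftn m); apply: cvg_trans h; apply: near_eq_cvg; near=> n.
rewrite /= addnK exprD.
by field; rewrite !expf_neq0 //= lt0r_neq0// Y_gt0.
Unshelve. all: by end_near.
Qed.

Theorem mainTheorem3 (R : realType) (r l kappa lambda epsilon z : R)
    (hr : 0 <= r) (hl : 0 <= l)
    (hkappa : -1 < kappa < 1) (hlambda : -1 < lambda < 1)
    (hepsilon : -1 < epsilon < 1) (hz : 0 < z) :
  let y := (1 - epsilon) / (1 + epsilon) in
  let f := r - l in
  let c := r * kappa - l * lambda in
  let rhoL := density y z in
  let jL := current y z r l kappa lambda epsilon in
  (forall L : nat, (4 <= L)%N -> forall k : 'Z_L,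
     [/\ site_density y z k = rhoL L,
         bond_current y z r l kappa lambda epsilon k = jL L,
         jL L =
           (f + c) * expect y z (fun eta => occ eta k * vac eta (k + 1))
           + (f * epsilon - c)
             * expect y z (fun eta => occ eta (k - 1) * occ eta k
                                      * vac eta (k + 1))
           - (f * epsilon + c)
             * expect y z (fun eta => occ eta (k - 1) * vac eta k
                                      * occ eta (k + 1))
       & jL L =
           (f + c
            - (f * (1 - epsilon) + 2 * c) * (y * z) * (Y y z (L - 1) / Y y z L)
            - ((f * epsilon + c) * z + (f * epsilon - c) * y ^+ 2 * z ^+ 2)
              * (Y y z (L - 2) / Y y z L)) * rhoL L])
  /\ cvgn rhoL
  /\ jL @ \oo -->
       (f + c
        - (f * (1 - epsilon) + 2 * c) * (y * z) * (lambda0 y z)^-1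
        - ((f * epsilon + c) * z + (f * epsilon - c) * y ^+ 2 * z ^+ 2)
          * (lambda0 y z) ^- 2) * limn rhoL.
Proof.
move=> y f c rhoL jL.
have y0 : 0 < y by case/andP: hepsilon => e1 e2; rewrite divr_gt0//; lra.
have rho_cvg : rhoL @ \oo --> limit_density y z by exact: cvg_density.
have j_ratio (L : nat) : (3 <= L)%N -> jL L =
    (f + c
     - (f * (1 - epsilon) + 2 * c) * (y * z) * (Y y z (L - 1) / Y y z L)
     - ((f * epsilon + c) * z + (f * epsilon - c) * y ^+ 2 * z ^+ 2)
       * (Y y z (L - 2) / Y y z L)) * rhoL L.
  by case: L => [|[|[|n]]] // _; rewrite /jL current_ratioE// subn1 subn2.
split; last split.
- move=> L L4 k; split.
  + exact: site_density_indep.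
  + by rewrite /jL /current !bond_currentE.
  + rewrite expect_gap_centered expect_occ_occ_vac expect_occ_vac.
    exact: bond_currentE.
  + by apply: j_ratio; rewrite ltnW.
- by apply/cvg_ex; exists (limit_density y z).
- rewrite (cvg_lim _ rho_cvg)//.
  have ratio1 := cvg_Y_ratio (m := 1) y0 hz.
  have ratio2 := cvg_Y_ratio (m := 2) y0 hz.
  rewrite expr1 in ratio1.
  apply: cvg_trans (cvgM (cvgB (cvgB (cvg_cst (f + c))
    (cvgM (cvg_cst ((f * (1 - epsilon) + 2 * c) * (y * z))) ratio1))
    (cvgM (cvg_cst ((f * epsilon + c) * z + (f * epsilon - c) * y ^+ 2 * z ^+ 2))
      ratio2)) rho_cvg).
  apply: near_eq_cvg; near=> L.
  by rewrite /= [RHS]j_ratio//; near: L; exact: nbhs_infty_ge.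
Unshelve. all: by end_near.
Qed.
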